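(* Assume that: (i) the function $\phi$ is bounded; (ii) the function $\psi(x):=\mathbb{E}[\phi(f(x,\Theta))]$ is globally Lipschitz continuous on $\mathbb{R}^d$; (iii) $\operatorname{supp}(\mu_X)\subset\operatorname{supp}(\mu_{X'})$; (iv) there exists an integer $m_0\ge1$ such that $\mathbb{E}\left[\min_{1\le j\le m_0}|X'_j|\right]<+\infty$; (v) $\mathbb{E}[|X|^2]<+\infty$, where $X\sim\mu_X$. Let $(k_m)_{m\ge1}$ be a sequence of positive integers with $k_m\le m$ such that $k_m\to+\infty$ and $k_m/m\to0$ when $m\to+\infty$. Then $$\mathbb{E}\left[\left|\widehat{\mathrm{QI}}_{m,n}^{(k_m)}-\mathrm{QI}\right|^2\right]^{1/2}\xrightarrow[n,m\to+\infty]{}0.$$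
   Context: $|\cdot|$ is a fixed norm on $\mathbb{R}^d$ (not necessarily Euclidean). $\mathbf{\Theta}$ is a measurable space, $f:\mathbb{R}^d\times\mathbf{\Theta}\to\mathbb{R}^e$ and $\phi:\mathbb{R}^e\to\mathbb{R}$ are measurable. $\mu_X,\mu_{X'}$ are probability measures on $\mathbb{R}^d$ and $\mu_\Theta$ a probability measure on $\mathbf{\Theta}$. $X\sim\mu_X$ and $\Theta\sim\mu_\Theta$ are independent, $Y=f(X,\Theta)$, and $\mathrm{QI}=\mathbb{E}[\phi(Y)]$. $(X_i)_{i\ge1}$ are i.i.d. with law $\mu_X$, $(X'_j)_{j\ge1}$ are i.i.d. with law $\mu_{X'}$, $(\Theta_j)_{j\ge1}$ are i.i.d. with law $\mu_\Theta$, and these three sequences are independent; $Y'_j=f(X'_j,\Theta_j)$. With $B(x,r)=\{x':|x-x'|\le r\}$, $\operatorname{supp}(\nu)=\{x\in\mathbb{R}^d:\forall r>0,\ \nu(B(x,r))>0\}$. The $k$-NN estimator is, for $k\in\{1,\dots,m\}$, $$\widehat{\mathrm{QI}}_{m,n}^{(k)}=\frac1m\sum_{j=1}^m w^{(k)}_j\phi(Y'_j),\qquad w^{(k)}_j:=\frac{m}{kn}\sum_{i=1}^n\sum_{l=1}^k\mathbf{1}_{\{j=j^{(l)}(X_i)\}},$$ where, for $x\in\mathbb{R}^d$, the indices $1,\dots,m$ are ordered by increasing distance $|x-X'_j|$, ties broken by lowest index, and $j^{(l)}(x)$ is the $l$-th index in this order (so $(j^{(l)}(x))_{1\le l\le m}$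 is a permutation of $\{1,\dots,m\}$). *)

(* Defs.v *)
From HB Require Import structures.
From mathcomp Require Import all_boot all_order all_algebra finmap.
From mathcomp Require Import all_classical all_reals all_analysis.
Set Implicit Arguments.
Unset Strict Implicit.
Unset Printing Implicit Defensive.
Import Order.TTheory GRing.Theory Num.Theory.
Import numFieldNormedType.Exports.
Local Open Scope classical_set_scope.
Local Open Scope ring_scope.

(* The library puts no sigma-algebra on matrices: we give 'M[R]_(m, n), hence
   'rV[R]_d, the Borel one.  The topology is that of the sup norm, which all
   norms on a finite-dimensional space induce. *)
HB.instance Definition _ (R : realType) (m n : nat) :=
  @isMeasurable.Build (sigma_display (@open 'M[R]_(m, n))) 'M[R]_(m, n)
    <<s @open 'M[R]_(m, n) >>
    (@sigma_algebra0 _ setT _) (@sigma_algebraC _ _)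
    (@sigma_algebra_bigcup _ setT _).

Definition is_norm (R : realType) (d : nat) (N : 'rV[R]_d -> R) : Prop :=
  [/\ forall x y, N (x + y) <= N x + N y,
      forall a x, N (a *: x) = `|a| * N x &
      forall x, N x = 0 -> x = 0].

Definition supp (R : realType) (d : nat) (N : 'rV[R]_d -> R)
    (nu : set 'rV[R]_d -> \bar R) : set 'rV[R]_d :=
  [set x | forall r : R, 0 < r -> (0 < nu [set x' | (N (x - x') <= r)%R])%E].

Section Independence.
Context (dT : measure_display) (T : measurableType dT) (R : realType).
Variable P : probability T R.

Definition mutually_independent (I : choiceType) (F : I -> set (set T)) : Prop :=
  forall (J : {fset I}) (A : I -> set T), (forall i, i \in J -> F i (A i)) ->
    P (\bigcap_(i in [set` J]) A i) = (\prod_(i <- J) P (A i))%E.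

Context (dV : measure_display) (V : measurableType dV).

(* Only measurable sets are tested: a measure, seen as a function, takes
   arbitrary values on the other ones. *)
Definition has_law (X : {RV P >-> V}) (mu : probability V R) : Prop :=
  forall A, measurable A -> distribution P X A = mu A.

Definition sigma_rv (X : {RV P >-> V}) : set (set T) :=
  g_sigma_algebra_preimage X.

Definition sigma_seq (X_ : nat -> {RV P >-> V}) : set (set T) :=
  <<s \bigcup_i sigma_rv (X_ i) >>.

Definition iid (X_ : nat -> {RV P >-> V}) (mu : probability V R) : Prop :=
  mutually_independent (fun i => sigma_rv (X_ i)) /\
  forall i, has_law (X_ i) mu.

End Independence.

(* Indices start at 0: the points called 1, ..., m in the usual notation are
   0, ..., m - 1 here, and the neighbour ranks 1, ..., k are 0, ..., k - 1.  In
   particular [nn N m x' x l] is j^(l+1)(x). *)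
Section NearestNeighbours.
Context (R : realType) (d : nat) (N : 'rV[R]_d -> R).

Definition closer (x' : nat -> 'rV[R]_d) (x : 'rV[R]_d) (i j : nat) : bool :=
  (N (x - x' i) < N (x - x' j)) ||
  ((N (x - x' i) == N (x - x' j)) && (i <= j)%N).

Definition nn (m : nat) (x' : nat -> 'rV[R]_d) (x : 'rV[R]_d) (l : nat) : nat :=
  nth 0%N (sort (closer x' x) (iota 0 m)) l.

Definition knn_weight (k m n : nat) (x x' : nat -> 'rV[R]_d) (j : nat) : R :=
  m%:R / (k%:R * n%:R) *
  \sum_(i < n) \sum_(l < k) (j == nn m x' (x i) l)%:R.

Definition knn_estimator (Th : Type) (e : nat)
    (f : 'rV[R]_d * Th -> 'rV[R]_e) (phi : 'rV[R]_e -> R) (k m n : nat)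
    (x x' : nat -> 'rV[R]_d) (theta : nat -> Th) : R :=
  m%:R^-1 *
  \sum_(j < m) knn_weight k m n x x' j * phi (f (x' j, theta j)).

End NearestNeighbours.

(* Main.v *)
Require Import Defs.
From mathcomp Require Import all_boot all_order all_algebra finmap.
From mathcomp Require Import all_classical all_reals all_analysis.
From mathcomp Require Import measurable_realfun.
From mathcomp Require Import ring lra zify.
Import Order.TTheory GRing.Theory Num.Theory.
Import numFieldNormedType.Exports.
Local Open Scope classical_set_scope.
Local Open Scope ring_scope.

(* Write c_j for the weight of the j-th point divided by m, so that
   0 <= c_j <= 1/k and sum_j c_j = 1, and split the error into
     sum_j c_j (phi(Y'_j) - psi(X'_j)),
     sum_j c_j psi(X'_j) - (1/n) sum_i psi(X_i),
     (1/n) sum_i psi(X_i) - QI.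
   The first and the last sums have orthogonal terms in L^2, hence second
   moments at most 4M^2/k and 4M^2/n where M bounds phi.  As psi is bounded and
   Lipschitz, the middle term is controlled by the probability that a ball
   B(X_i, eps) contains fewer than k of the points X'_1, ..., X'_m.  By
   Chebyshev, conditionally on X_i, this is small unless the muX'-mass of
   B(X_i, eps) is at most delta, an event whose probability tends to 0 with
   delta because muX-almost every point lies in supp muX, hence in supp muX'. *)

Set Implicit Arguments.
Unset Strict Implicit.
Unset Printing Implicit Defensive.

(** * Bounded measurable functions *)

(** No conditional expectation is ever formed. Each argument made conditionally on some variables
    becomes the vanishing of an integral: one random element is independent of all the others in the
    integrand, and integrating over it alone gives 0 for every frozen value of the rest. Since [phi]
    is bounded, so are all integrands, and integrability reduces to the predicate below.

    For the middle term, the square is at most [2 * M] times a bound on the absolute value, so a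
    first moment suffices. That bound is an average over [i] of terms with a common estimate, hence
    it is uniform in [n]; this is what the joint limit in [n] and [m] asks for. The parameters are
    chosen in the order eps, delta, then thresholds for [m] and [n]. *)

Definition bounded_measurable d (T : measurableType d) (R : realType)
    (f : T -> R) : Prop :=
  measurable_fun setT f /\ exists M : R, forall x, `|f x| <= M.

Section BoundedMeasurable.
Context d (T : measurableType d) (R : realType).
Implicit Types f g : T -> R.

Lemma bmf_cst (c : R) : bounded_measurable (fun _ : T => c).
Proof. by split; [exact: measurable_cst|exists `|c|]. Qed.

Lemma bmfD f g : bounded_measurable f -> bounded_measurable g ->
  bounded_measurable (fun x => f x + g x).
Proof.
move=> [mf [A fA]] [mg [B gB]]; split; first exact: measurable_funD.
by exists (A + B) => x; rewrite (le_trans (ler_normD _ _))// lerD.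
Qed.

Lemma bmfN f : bounded_measurable f -> bounded_measurable (fun x => - f x).
Proof.
move=> [mf [A fA]]; split; first exact: measurableT_comp.
by exists A => x; rewrite normrN.
Qed.

Lemma bmfB f g : bounded_measurable f -> bounded_measurable g ->
  bounded_measurable (fun x => f x - g x).
Proof. by move=> bf bg; apply: bmfD => //; exact: bmfN. Qed.

Lemma bmfM f g : bounded_measurable f -> bounded_measurable g ->
  bounded_measurable (fun x => f x * g x).
Proof.
move=> [mf [A fA]] [mg [B gB]]; split; first exact: measurable_funM.
by exists (A * B) => x; rewrite normrM ler_pM.
Qed.

Lemma bmfX f n : bounded_measurable f -> bounded_measurable (fun x => f x ^+ n).
Proof.
move=> bf; elim: n => [|n IH]; first exact: bmf_cst.
by under eq_fun do rewrite exprS; exact: bmfM.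
Qed.

Lemma bmf_sum (I : Type) (s : seq I) (F : I -> T -> R) :
  (forall i, bounded_measurable (F i)) ->
  bounded_measurable (fun x => \sum_(i <- s) F i x).
Proof.
move=> bF; elim: s => [|i s IH].
  by under eq_fun do rewrite big_nil; exact: bmf_cst.
by under eq_fun do rewrite big_cons; exact: bmfD.
Qed.

Lemma bmf_bool (b : T -> bool) : measurable_fun setT b ->
  bounded_measurable (fun x => (b x)%:R : R).
Proof.
move=> mb; split; last by exists 1 => x; case: (b x); rewrite ?normr1 ?normr0.
by rewrite (_ : (fun _ => _) = (fun c : bool => c%:R) \o b)//;
  exact: measurableT_comp.
Qed.

Lemma bmf_comp d' (T' : measurableType d') (h : T' -> R) (u : T -> T') :
  bounded_measurable h -> measurable_fun setT u ->
  bounded_measurable (fun x => h (u x)).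
Proof.
by move=> [mh [M hM]] mu; split; [exact: measurableT_comp|exists M].
Qed.

Variable P : probability T R.

Lemma bmf_integrable f : bounded_measurable f ->
  P.-integrable setT (EFin \o f).
Proof.
move=> [mf [M fM]]; apply: measurable_bounded_integrable => //.
  by rewrite -ge0_fin_numE// fin_num_measure.
exists M; split; first exact: num_real.
by move=> r Mr x _; exact: le_trans (fM x) (ltW Mr).
Qed.

Lemma bmf_expectation f : bounded_measurable f ->
  'E_P[f]%E = (\int[P]_x f x)%:E.
Proof.
move=> bf; rewrite unlock /Rintegral fineK//.
exact: integrable_fin_num (bmf_integrable bf).
Qed.

Lemma bmf_RintegralD f g : bounded_measurable f -> bounded_measurable g ->
  \int[P]_x (f x + g x) = \int[P]_x f x + \int[P]_x g x.
Proof. by move=> ? ?; rewrite RintegralD//; exact: bmf_integrable. Qed.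

Lemma bmf_RintegralZ (c : R) f : bounded_measurable f ->
  \int[P]_x (c * f x) = c * \int[P]_x f x.
Proof. by move=> ?; rewrite RintegralZl//; exact: bmf_integrable. Qed.

Lemma bmf_Rintegral_sum (I : Type) (s : seq I) (F : I -> T -> R) :
  (forall i, bounded_measurable (F i)) ->
  \int[P]_x (\sum_(i <- s) F i x) = \sum_(i <- s) \int[P]_x F i x.
Proof.
move=> bF; elim: s => [|i s IH].
  under eq_Rintegral do rewrite big_nil.
  by rewrite big_nil Rintegral_cst// mul0r.
under eq_Rintegral do rewrite big_cons.
by rewrite big_cons bmf_RintegralD ?IH//; exact: bmf_sum.
Qed.

Lemma Rintegral_prob_cst (c : R) : \int[P]_x c = c.
Proof. by rewrite Rintegral_cst// (congr1 fine (probability_setT P : P setT = _)) mulr1. Qed.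

Lemma bmf_RintegralB_cst f (c : R) : bounded_measurable f ->
  \int[P]_x (f x - c) = \int[P]_x f x - c.
Proof.
move=> bf; rewrite bmf_RintegralD//; last exact: bmf_cst.
by rewrite Rintegral_prob_cst.
Qed.

Lemma bmf_le_Rintegral f g : bounded_measurable f -> bounded_measurable g ->
  (forall x, f x <= g x) -> \int[P]_x f x <= \int[P]_x g x.
Proof.
by move=> ? ? fg; apply: le_Rintegral => //; exact: bmf_integrable.
Qed.

Lemma bmf_Rintegral_le_cst f (c : R) : bounded_measurable f ->
  (forall x, f x <= c) -> \int[P]_x f x <= c.
Proof.
move=> bf fc; rewrite -[leRHS]Rintegral_prob_cst.
by apply: bmf_le_Rintegral => //; exact: bmf_cst.
Qed.

Lemma Rintegral_bool (b : T -> bool) : measurable_fun setT b ->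
  \int[P]_x (b x)%:R = fine (P [set x | b x]).
Proof.
move=> mb.
have mA : measurable [set x | b x] by rewrite -[X in measurable X]setTI; exact: mb.
have H := integral_indic P measurableT mA; rewrite setIT in H.
rewrite /Rintegral -H; congr fine.
by apply: eq_integral => x _; rewrite indicE mem_setE.
Qed.

(** Plays the part of the additivity of variances. Orthogonality is phrased as a vanishing integral
    because [indep_Rintegral_eq0] delivers it in that form. *)
Lemma Rintegral_sqr_sum_orthogonal (m : nat) (F : 'I_m -> T -> R) :
  (forall i, bounded_measurable (F i)) ->
  (forall i j, i != j -> \int[P]_x (F i x * F j x) = 0) ->
  \int[P]_x ((\sum_i F i x) ^+ 2) = \sum_i \int[P]_x (F i x ^+ 2).
Proof.
move=> bF orth.
under eq_Rintegral do rewrite expr2 big_distrlr/=.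
rewrite bmf_Rintegral_sum; last first.
  by move=> i; apply: bmf_sum => j; exact: bmfM.
apply: eq_bigr => i _.
rewrite bmf_Rintegral_sum; last by move=> j; exact: bmfM.
rewrite (bigD1 i)//= big1 ?addr0//; last by move=> j ji; rewrite orth// eq_sym.
Qed.

End BoundedMeasurable.

(** * Independence *)

Section IndependencePair.
Context d (T : measurableType d) (R : realType) (P : probability T R).

Lemma preimage_measurable d' (V : measurableType d') (U : T -> V) (A : set V) :
  measurable_fun setT U -> measurable A -> measurable (U @^-1` A).
Proof. by move=> mU mA; rewrite -[X in measurable X]setTI; exact: mU. Qed.

(** Pi-lambda argument: for fixed [D], the sets [S] obeying the product rule contain the whole space
    and are stable under complement, as [P] is finite, and under countable disjoint union. *)
Lemma dynkin_indep d' (V : measurableType d') (U : T -> V) (G : set (set V))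
    (D : set T) : measurable_fun setT U -> measurable D ->
  @measurable _ V = <<s G >> -> setI_closed G ->
  (forall A, G A -> P (U @^-1` A `&` D) = P (U @^-1` A) * P D)%E ->
  forall S, measurable S -> P (U @^-1` S `&` D) = (P (U @^-1` S) * P D)%E.
Proof.
move=> mU mD GE GI GP S; rewrite GE; move: S.
apply: (@dynkin_induction _ V G) => //.
- have PT : P (U @^-1` setT) = 1%E by rewrite preimage_setT; exact: probability_setT.
  by rewrite PT preimage_setT setTI mul1e.
- move=> S mS HS; have mUS := preimage_measurable mU mS.
  have PD : (P (~` (U @^-1` S) `&` D) = P D - P (U @^-1` S `&` D))%E.
    rewrite setIC -setDE (setIC _ D); apply: measureD => //.
    by rewrite -ge0_fin_numE// fin_num_measure.
  rewrite preimage_setC PD HS probability_setC//.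
  rewrite -(fineK (fin_num_measure P _ mD)) -(fineK (fin_num_measure P _ mUS)).
  by rewrite -EFinM -!EFinB -EFinM; congr (_%:E); ring.
- move=> F mF tF HF; have mUF n := preimage_measurable mU (mF n).
  have tUF : trivIset setT (fun n => U @^-1` F n) 
    by move=> i j _ _ [x [Fix Fjx]]; apply: tF => //; exists (U x).
  have -> : P (U @^-1` (\bigcup_k F k) `&` D) =
      (\sum_(n <oo) P (U @^-1` F n `&` D))%E.
    rewrite preimage_bigcup setI_bigcupl; apply: measure_semi_bigcup.
    + by move=> n; exact: measurableI.
    + exact: trivIset_setIr tUF.
    + by apply: bigcupT_measurable => n; exact: measurableI.
  have -> : P (U @^-1` (\bigcup_k F k)) = (\sum_(n <oo) P (U @^-1` F n))%E.
    rewrite preimage_bigcup; apply: measure_semi_bigcup => //.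
    exact: bigcupT_measurable.
  rewrite muleC -(fineK (fin_num_measure P _ mD)) -nneseriesZl; last first.
    by move=> n _; exact: measure_ge0.
  by apply: eq_eseriesr => n _; rewrite HF muleC fineK// fin_num_measure.
Qed.

Context d1 (V1 : measurableType d1) d2 (V2 : measurableType d2)
  d3 (V3 : measurableType d3).

(** Rectangles are stable under intersection and generate the product sigma-algebra. As [D] is an
    arbitrary event, the lemma can be iterated, adjoining one variable at a time. *)
Lemma indep_pair_rectangle (U1 : T -> V1) (U2 : T -> V2) (D : set T) :
  measurable_fun setT U1 -> measurable_fun setT U2 -> measurable D ->
  (forall A B, measurable A -> measurable B ->
    P (U1 @^-1` A `&` U2 @^-1` B `&` D) =
    P (U1 @^-1` A `&` U2 @^-1` B) * P D)%E ->
  forall S : set (V1 * V2), measurable S ->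
    P ((fun w => (U1 w, U2 w)) @^-1` S `&` D) =
    (P ((fun w => (U1 w, U2 w)) @^-1` S) * P D)%E.
Proof.
move=> mU1 mU2 mD H.
apply: (dynkin_indep _ mD (@measurable_prod_measurableType _ _ V1 V2)).
- exact: measurable_fun_pair.
- move=> _ _ [A1 mA1 [A2 mA2 <-]] [B1 mB1 [B2 mB2 <-]].
  exists (A1 `&` B1); first exact: measurableI.
  exists (A2 `&` B2); first exact: measurableI.
  by rewrite setXI.
- by move=> _ [A mA [B mB <-]]; exact: H.
Qed.

Lemma has_law_Rintegral (U : {RV P >-> V1}) (mu : probability V1 R) (h : V1 -> R) :
  has_law U mu -> bounded_measurable h ->
  \int[P]_w h (U w) = \int[mu]_x h x.
Proof.
move=> lawU bh; rewrite /Rintegral; congr fine.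
rewrite -(@integral_distribution _ _ _ _ _ P U (EFin \o h)).
- by apply: eq_measure_integral => A mA _; exact: lawU.
- by apply/measurable_EFinP; case: bh.
- have bhU : bounded_measurable (h \o U) by exact: bmf_comp.
  exact: (bmf_integrable P bhU).
Qed.

(* Independence turns the joint law into a product measure, so Fubini applies. *)
Lemma indep_Rintegral_eq0 (U : T -> V1) (W : T -> V2) (h : V1 * V2 -> R) :
  measurable_fun setT U -> measurable_fun setT W -> bounded_measurable h ->
  (forall A B, measurable A -> measurable B ->
    P (U @^-1` A `&` W @^-1` B) = P (U @^-1` A) * P (W @^-1` B))%E ->
  (forall u, \int[P]_w h (u, W w) = 0) ->
  \int[P]_w h (U w, W w) = 0.
Proof.
move=> mU mW bh ind h0.
pose fU : {RV P >-> V1} := mfun_Sub (mem_set mU).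
pose fW : {RV P >-> V2} := mfun_Sub (mem_set mW).
pose fUW : {RV P >-> (V1 * V2)%type} :=
  mfun_Sub (mem_set (measurable_fun_pair mU mW)).
have bhUW : bounded_measurable (h \o fUW).
  exact: (bmf_comp bh (measurable_fun_pair mU mW)).
have mh : measurable_fun setT (EFin \o h).
  by apply/measurable_EFinP; case: bh.
have joint S : measurable S ->
    (distribution P fU \x distribution P fW)%E S = distribution P fUW S.
  by apply: product_measure_unique => A B mA mB; exact: ind.
have key : (\int[P]_w (h (U w, W w))%:E = 0)%E.
  transitivity (\int[distribution P fUW]_z (h z)%:E)%E.
    rewrite (@integral_distribution _ _ _ _ _ P fUW (EFin \o h))//.
    exact: (bmf_integrable P bhUW).
  transitivity (\int[(distribution P fU \x distribution P fW)%E]_z (h z)%:E)%E.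
    by apply: eq_measure_integral => S mS _; apply/esym/joint.
  rewrite -(@integral12_prod_meas1 _ _ _ _ _ _ _ (EFin \o h)) /=; last first.
    apply: measurable_bounded_integrable => //.
    - have joint_lty : ((distribution P fU \x distribution P fW) setT < +oo)%E.
        rewrite joint//.
        exact: (le_lt_trans (probability_le1 _ measurableT) (ltry 1)).
      exact: joint_lty.
    - by case: bh.
    - case: bh => _ [M hM]; exists M; split; first exact: num_real.
      by move=> r Mr x _; exact: le_trans (hM x) (ltW Mr).
  apply: integral0_eq => u _; rewrite /fubini_F/=.
  have mhu : measurable_fun setT (fun y => (h (u, y))%:E).
    exact: (measurableT_comp mh (measurable_pair1 u)).
  have bhu : bounded_measurable (fun w => h (u, fW w)).
    split; first by apply/measurable_EFinP; exact: (measurableT_comp mhu mW).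
    by case: bh => _ [M hM]; exists M => w.
  rewrite (@integral_distribution _ _ _ _ _ P fW (fun y => (h (u, y))%:E))//=; last first.
    exact: (bmf_integrable P bhu).
  (* The hypothesis only speaks of [fine] of the integral; finiteness, from boundedness, turns it
     into an equality of extended reals. *)
  have := h0 u; rewrite /Rintegral => h0u.
  rewrite -[LHS]fineK ?h0u//; exact: integrable_fin_num (bmf_integrable P bhu).
by rewrite /Rintegral key.
Qed.

End IndependencePair.

(** * Borel sets and a norm *)

Section NormedBorel.
Context (R : realType) (d : nat) (N : 'rV[R]_d -> R).
Hypothesis hN : is_norm N.

Let ND x y : N (x + y) <= N x + N y. Proof. by case: hN. Qed.
Let NZ a x : N (a *: x) = `|a| * N x. Proof. by case: hN. Qed.

Lemma is_norm0 : N 0 = 0.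
Proof. by rewrite -(scale0r (0 : 'rV[R]_d)) NZ normr0 mul0r. Qed.

Lemma is_normN x : N (- x) = N x.
Proof. by rewrite -scaleN1r NZ normrN1 mul1r. Qed.

Lemma is_normC x y : N (x - y) = N (y - x).
Proof. by rewrite -is_normN opprB. Qed.

(** Derived from the triangle inequality: [0 = N (x - x) <= N x + N (- x)], which is twice [N x]. *)
Lemma is_norm_ge0 x : 0 <= N x.
Proof. by have := ND x (- x); rewrite subrr is_norm0 is_normN -mulr2n pmulrn_lge0. Qed.

Lemma is_norm_triangle z x y : N (x - y) <= N (x - z) + N (y - z).
Proof. by rewrite (is_normC y z); have := ND (x - z) (z - y); rewrite addrA subrK. Qed.

(** Expansion in the canonical basis. It says that small sup-norm balls are small for [N], which
    links [N] to the topology generating the Borel sets. *)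
Lemma is_norm_coord_le (e : R) (x : 'rV[R]_d) : (forall j, `|x 0 j| <= e) ->
  N x <= e * \sum_j N 'e_j.
Proof.
move=> xe; rewrite (row_sum_delta x).
have Nsum (s : seq 'I_d) (F : 'I_d -> 'rV[R]_d) :
    N (\sum_(j <- s) F j) <= \sum_(j <- s) N (F j).
  elim: s => [|j s IH]; first by rewrite !big_nil is_norm0.
  by rewrite !big_cons (le_trans (ND _ _))// lerD2l.
apply: (le_trans (Nsum _ _)); rewrite mulr_sumr; apply: ler_sum => j _.
by rewrite NZ ler_wpM2r// is_norm_ge0.
Qed.

Let S : R := \sum_j N 'e_j.
Let S_ge0 : 0 <= S. Proof. by apply: sumr_ge0 => j _; exact: is_norm_ge0. Qed.

(** The [+ 1] keeps the denominator positive when [d = 0], where [S] is an empty sum. *)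
Let scale_lt (e : R) : 0 < e -> e / (S + 1) * S < e.
Proof.
move=> e0; have S1 : 0 < S + 1 by rewrite ltr_wpDl.
rewrite mulrAC ltr_pdivrMr// ltr_pM2l//; lra.
Qed.

Lemma is_norm_lipschitz_measurable (g : 'rV[R]_d -> R) (K : R) :
  (forall x y, `|g x - g y| <= K * N (x - y)) -> measurable_fun setT g.
Proof.
move=> gK.
apply: (measurability _ (RGenOInfty.measurableE R)) => //.
move=> _ [_ [a ->] <-]; rewrite setTI.
suff op : open (g @^-1` `]a, +oo[) by exact: sub_sigma_algebra.
rewrite openE => x /=; rewrite in_itv/= andbT => agx.
(* The constant [K] may be zero or negative, so the radius is divided by [|K| + 1] instead. *)
have K1 : 0 < `|K| + 1 by rewrite ltr_wpDl.
have e0 : 0 < (g x - a) / (`|K| + 1) by rewrite divr_gt0// subr_gt0.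
rewrite /interior; apply/nbhs_ballP.
exists ((g x - a) / (`|K| + 1) / (S + 1)) => /=.
  by rewrite divr_gt0// ltr_wpDl.
move=> y [_ xy] /=; rewrite in_itv/= andbT.
have Nxy : N (x - y) < (g x - a) / (`|K| + 1).
  apply: le_lt_trans (scale_lt e0); apply: is_norm_coord_le => j.
  by rewrite !mxE; exact/ltW/xy.
have := gK x y; have KN : K * N (x - y) <= `|K| * N (x - y).
  by rewrite ler_wpM2r// ?is_norm_ge0// ler_norm.
have : (`|K| + 1) * N (x - y) < g x - a by rewrite mulrC -ltr_pdivlMr.
have := is_norm_ge0 (x - y); have := ler_norm (g x - g y).
by rewrite mulrDl mul1r; lra.
Qed.

Lemma is_norm_sub_measurable q : measurable_fun setT (fun x : 'rV[R]_d => N (x - q)).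
Proof.
apply: (@is_norm_lipschitz_measurable _ 1) => x y; rewrite mul1r ler_norml.
have := is_norm_triangle y x q; have := is_norm_triangle x y q.
by rewrite (is_normC q) (is_normC y x) (is_normC q y); lra.
Qed.

Lemma is_norm_dense :
  exists q : nat -> 'rV[R]_d, forall x (e : R), 0 < e -> exists n, N (x - q n) < e.
Proof.
(* Enumeration of the rational vectors; integers that code no vector are sent to 0, which is
   harmless for density. *)
pose q (n : nat) : 'rV[R]_d :=
  if choice.unpickle n is Some v then map_mx ratr (v : 'rV[rat]_d) else 0.
exists q => x e e0.
have e1 : 0 < e / (S + 1) by rewrite divr_gt0// ltr_wpDl.
have /choice[v xv] : forall j : 'I_d, exists r : rat, `|x 0 j - ratr r| <= e / (S + 1).
  move=> j; have [|r] := @rat_in_itvoo R (x 0 j) (x 0 j + e / (S + 1)).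
    by rewrite ltrDl.
  rewrite in_itv/= => /andP[r1 r2]; exists r.
  by rewrite distrC ger0_norm ?subr_ge0 1?ltW// ltrBlDl.
exists (choice.pickle (\row_j v j)); rewrite /q choice.pickleK.
apply: le_lt_trans (scale_lt e0); apply: is_norm_coord_le => j.
by rewrite !mxE; exact: xv.
Qed.

(* N(U - V) is the infimum over a dense sequence q of N(U - q n) + N(V - q n);
   this avoids comparing the Borel sets of the square with the product ones. *)
Lemma is_norm_dist_measurable d' (T : measurableType d') (U V : T -> 'rV[R]_d) :
  measurable_fun setT U -> measurable_fun setT V ->
  measurable_fun setT (fun w => N (U w - V w)).
Proof.
move=> mU mV; have [q hq] := is_norm_dense.
apply: (measurability _ (RGenInftyO.measurableE R)) => //.
move=> _ [_ [a ->] <-]; rewrite setTI.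
rewrite [X in measurable X](_ : _ =
    \bigcup_n [set w | N (U w - q n) + N (V w - q n) < a]).
  apply: bigcupT_measurable => n.
  have mUV : measurable_fun setT (fun w => N (U w - q n) + N (V w - q n)).
    apply: measurable_funD.
    - exact: (measurableT_comp (is_norm_sub_measurable (q n)) mU).
    - exact: (measurableT_comp (is_norm_sub_measurable (q n)) mV).
  rewrite [X in measurable X](_ : _ =
      (fun w => N (U w - q n) + N (V w - q n)) @^-1` `]-oo, a[).
    by rewrite -[X in measurable X]setTI; exact: (mUV measurableT _ (measurable_itv _)).
  by apply/seteqP; split=> w /=; rewrite in_itv.
apply/seteqP; split=> w /=; rewrite in_itv/=.
  (* The gap is halved because [N (V w - q n)] is paid twice: once as such, once in the triangle
     inequality for [N (U w - q n)]. *)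
  move=> UVa; have [|n Vn] := hq (V w) ((a - N (U w - V w)) / 2).
    by rewrite divr_gt0// subr_gt0.
  exists n => //=; have := is_norm_triangle (V w) (U w) (q n).
  by rewrite (is_normC (q n)); lra.
by case=> n _; exact: le_lt_trans (is_norm_triangle _ _ _).
Qed.

Lemma is_norm_ball_measurable x r : measurable [set x' | N (x - x') <= r].
Proof.
have m : measurable_fun setT (fun x' : 'rV[R]_d => N (x - x')).
  by under eq_fun do rewrite is_normC; exact: is_norm_sub_measurable.
rewrite [X in measurable X](_ : _ = (fun x' : 'rV[R]_d => N (x - x')) @^-1` `]-oo, r]).
  by rewrite -[X in measurable X]setTI; exact: (m measurableT _ (measurable_itv _)).
by apply/seteqP; split=> w /=; rewrite in_itv.
Qed.

(* Outside the support every point lies in one of the countably many null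
   balls with rational centre and radius 1 / (k + 1). *)
Lemma supp_setC_negligible (mu : probability 'rV[R]_d R) :
  mu.-negligible (~` supp N mu).
Proof.
have [q hq] := is_norm_dense.
pose B n k : set 'rV[R]_d := [set x' | N (q n - x') <= k.+1%:R^-1].
pose F n k : set 'rV[R]_d := if mu (B n k) == 0%E then B n k else set0.
apply: (@negligibleS _ _ _ mu (\bigcup_n \bigcup_k F n k)); last first.
  apply: negligible_bigcup => n; apply: negligible_bigcup => k.
  rewrite /F; case: eqP => [B0|_]; last exact: negligible_set0.
  exists (B n k); split => //; exact: is_norm_ball_measurable.
move=> x /=; rewrite /supp/= => /existsNP[r /not_implyP[r0 /negP]].
rewrite -leNgt => Br0.
(* With a radius below [r / 2], a ball centred at [q n] and containing [x] lies inside the null ball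
   of radius [r] around [x]. *)
have [k /andP[_ kr]] : exists k, (0 <= k)%N && (k.+1%:R^-1 < r / 2).
  have [k] := ltr_add_invr (divr_gt0 r0 (ltr0Sn R 1)).
  by rewrite add0r => kr; exists k.
have [|n xn] := hq x k.+1%:R^-1; first by rewrite invr_gt0.
exists n => //; exists k => //; rewrite /F.
have -> : mu (B n k) == 0%E.
  rewrite eq_le measure_ge0 andbT; apply: le_trans Br0.
  apply: le_measure; rewrite ?inE; [exact: is_norm_ball_measurable..|].
  move=> y; change (N (q n - y) <= k.+1%:R^-1 -> N (x - y) <= r) => ny.
  have := is_norm_triangle (q n) x y.
  rewrite (is_normC y); move: kr xn ny; set z : R := k.+1%:R^-1; lra.
by rewrite /B/= is_normC ltW.
Qed.

End NormedBorel.

(** * Nearest neighbours *)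

Section NearestNeighbourFacts.
Context (R : realType) (d : nat) (N : 'rV[R]_d -> R).
Implicit Types (m l k n : nat).

Lemma closer_total (x' : nat -> 'rV[R]_d) (x : 'rV[R]_d) : total (closer N x' x).
Proof.
by move=> i j; rewrite /closer; case: ltgtP => //= _; exact: leq_total.
Qed.

Lemma closer_trans (x' : nat -> 'rV[R]_d) (x : 'rV[R]_d) : transitive (closer N x' x).
Proof.
move=> j i l; rewrite /closer => /orP[ij|/andP[/eqP-> ij]] /orP[jl|/andP[/eqP jl jl']].
- by rewrite (lt_trans ij jl).
- by rewrite -jl ij.
- by rewrite jl.
- by rewrite jl eqxx (leq_trans ij jl') orbT.
Qed.

Let nns m (x' : nat -> 'rV[R]_d) (x : 'rV[R]_d) := sort (closer N x' x) (iota 0 m).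

Let size_nns m x' x : size (nns m x' x) = m.
Proof. by rewrite size_sort size_iota. Qed.

Lemma nn_lt m (x' : nat -> 'rV[R]_d) (x : 'rV[R]_d) l : (l < m)%N -> (nn N m x' x l < m)%N.
Proof.
move=> lm; have : nn N m x' x l \in nns m x' x by rewrite mem_nth// size_nns.
by rewrite mem_sort mem_iota.
Qed.

Lemma nn_inj m (x' : nat -> 'rV[R]_d) (x : 'rV[R]_d) l l' : (l < m)%N -> (l' < m)%N ->
  (nn N m x' x l == nn N m x' x l') = (l == l').
Proof.
by move=> lm lm'; rewrite nth_uniq ?size_nns// sort_uniq iota_uniq.
Qed.

(** If the neighbour of rank [l] were farther than [e], so would be all later ones, the list being
    sorted. Only the [l] first indices could then lie in the ball, fewer than [k]. *)
Lemma nn_dist_le m k (x' : nat -> 'rV[R]_d) (x : 'rV[R]_d) l (e : R) : (l < k)%N ->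
  (k <= \sum_(j < m) (N (x - x' j) <= e)%R)%N -> N (x - x' (nn N m x' x l)) <= e.
Proof.
move=> lk kle; rewrite leNgt; apply/negP => far.
have Esum : (\sum_(j < m) (N (x - x' j) <= e)%R =
    count (fun j => N (x - x' j) <= e)%R (nns m x' x))%N.
  rewrite (permP (permEl (perm_sort _ _))) -sum1_count.
  by rewrite -(big_mkord xpredT (fun j => nat_of_bool (N (x - x' j) <= e)))
    /index_iota subn0 [RHS]big_mkcond; apply: eq_bigr => j _; case: ifP.
have dropl : count (fun j => N (x - x' j) <= e)%R (drop l (nns m x' x)) = 0%N.
  apply/eqP; rewrite -leqn0 leqNgt -has_count; apply/hasPn => j jin.
  rewrite -ltNge; apply: (lt_le_trans far).
  have /(nthP 0%N)[i ilt ji] := jin.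
  rewrite -ji nth_drop.
  have : sorted (closer N x' x) (nns m x' x) by exact/sort_sorted/closer_total.
  move=> /(sorted_leq_nth (@closer_trans x' x)).
  have crefl : reflexive (closer N x' x).
    by move=> i'; have := closer_total x' x i' i'; rewrite orbb.
  rewrite size_drop size_nns in ilt.
  move=> /(_ crefl 0%N l (l + i)%N); rewrite !inE size_nns.
  have li : (l + i < m)%N by lia.
  have lm : (l < m)%N by lia.
  move=> /(_ lm li (leq_addr _ _)); rewrite /closer.
  by case/orP => [/ltW//|/andP[/eqP-> _]].
have := count_cat (fun j => N (x - x' j) <= e) (take l (nns m x' x)) (drop l (nns m x' x)).
rewrite cat_take_drop dropl addn0 -Esum => E.
have := count_size (fun j => N (x - x' j) <= e) (take l (nns m x' x)).
have := size_take_min l (nns m x' x); lia.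
Qed.

(** Exchange of sums: for each query and each rank, exactly one index [j] is selected. A general [g]
    serves both for the total weight ([g] constant) and for the bias ([g] the values of [psi]). *)
Lemma sum_nn_weight_mul k m n (x x' : nat -> 'rV[R]_d) (g : nat -> R) :
  (0 < m)%N -> (k <= m)%N ->
  \sum_(j < m) m%:R^-1 * knn_weight N k m n x x' j * g j =
  n%:R^-1 * \sum_(i < n) (k%:R^-1 * \sum_(l < k) g (nn N m x' (x i) l)).
Proof.
move=> m0 km.
have mr : (m%:R : R) != 0 by rewrite pnatr_eq0 -lt0n.
rewrite /knn_weight.
under eq_bigr => j _.
  rewrite mulrA mulrA mulVf// mul1r -mulrA mulr_suml.
  under eq_bigr do rewrite mulr_suml.
  over.
rewrite -mulr_sumr exchange_big/=.
under eq_bigr do rewrite exchange_big/=.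
rewrite invfM (mulrC k%:R^-1) -mulrA; congr (_ * _).
rewrite mulr_sumr; apply: eq_bigr => i _; congr (_ * _).
apply: eq_bigr => l _.
have lm : (nn N m x' (x i) l < m)%N by apply: nn_lt; exact: leq_trans km.
rewrite (bigD1 (Ordinal lm))//= eqxx mul1r big1 ?addr0// => j.
by rewrite -val_eqE/= => /negPf ->; rewrite mul0r.
Qed.

Lemma nn_weight_ge0 k m n (x x' : nat -> 'rV[R]_d) j :
  0 <= m%:R^-1 * knn_weight N k m n x x' j.
Proof.
rewrite mulr_ge0// mulr_ge0// ?divr_ge0// ?mulr_ge0//.
by apply: sumr_ge0 => i _; apply: sumr_ge0.
Qed.

(** A given index occupies at most one rank among the neighbours of each query, so each of the [n]
    queries contributes at most 1 to the double sum. *)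
Lemma nn_weight_le k m n (x x' : nat -> 'rV[R]_d) j :
  (0 < m)%N -> (0 < n)%N -> (0 < k <= m)%N ->
  m%:R^-1 * knn_weight N k m n x x' j <= k%:R^-1.
Proof.
move=> m0 n0 /andP[k0 km].
have mr : (m%:R : R) != 0 by rewrite pnatr_eq0 -lt0n.
rewrite /knn_weight mulrA mulrA mulVf// mul1r invfM -mulrA.
rewrite ler_piMr ?invr_ge0//.
rewrite mulrC ler_pdivrMr ?ltr0n// mul1r.
apply: (@le_trans _ _ (\sum_(i < n) (1 : R))); last first.
  by rewrite sumr_const card_ord.
apply: ler_sum => i _.
have [[l jl]|no] := pselect (exists l : 'I_k, j = nn N m x' (x i) l).
  rewrite (bigD1 l)//= jl eqxx big1 ?addr0// => l' l'l.
  by rewrite nn_inj ?(leq_trans _ km)// (eq_sym (l : nat)) val_eqE (negPf l'l).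
rewrite big1// => l _; case: eqP => // jl; case: no; by exists l.
Qed.

Section Measurability.
Context d' (T : measurableType d') (hN : is_norm N).

(** The preimage of a set is a finite union of the atoms on which all the booleans [b i] are fixed.
    The intended use is [nn], whose value depends only on the outcomes of finitely many
    comparisons. *)
Lemma measurable_fun_finite (I : finType) dV (V : measurableType dV)
    (b : I -> T -> bool) (H : {ffun I -> bool} -> V) :
  (forall i, measurable_fun setT (b i)) ->
  measurable_fun setT (fun w => H [ffun i => b i w]).
Proof.
move=> mb _ Y mY; rewrite setTI.
rewrite [X in measurable X](_ : _ = \bigcup_(c in [set c | Y (H c)])
    \bigcap_(i in [set: I]) (b i @^-1` [set c i])).
  apply: fin_bigcup_measurable; first exact: finite_finset.
  move=> c _; rewrite -[X in measurable X]setCK setC_bigcap.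
  apply/measurableC/fin_bigcup_measurable; first exact: finite_finset.
  move=> i _; apply: measurableC.
  by rewrite -[X in measurable X]setTI; exact: (mb i measurableT).
apply/seteqP; split=> w /=.
  by move=> YH; exists [ffun i => b i w] => // i _; rewrite ffunE.
case=> c Yc bc; suff -> : [ffun i => b i w] = c by [].
by apply/ffunP => i; rewrite ffunE; exact: bc.
Qed.

Lemma nn_measurable m l (x' : nat -> T -> 'rV[R]_d) (x : T -> 'rV[R]_d) :
  (forall j, measurable_fun setT (x' j)) -> measurable_fun setT x ->
  measurable_fun setT (fun w => nn N m (x' ^~ w) (x w) l).
Proof.
move=> mx' mx.
pose b (p : 'I_m * 'I_m) w := closer N (x' ^~ w) (x w) p.1 p.2.
(* Sorting is redone on ['I_m], with the order read from the finite table [c] of all pairwise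
   comparisons. *)
pose H (c : {ffun 'I_m * 'I_m -> bool}) :=
  nth 0%N (map val (sort (fun i j => c (i, j)) (enum 'I_m))) l.
rewrite (_ : (fun w => _) = (fun w => H [ffun p => b p w])); last first.
  apply/funext => w; rewrite /nn /H -val_enum_ord sort_map; congr (nth _ (map _ _) _).
  by congr sort; apply/funext => i; apply/funext => j; rewrite ffunE.
apply: measurable_fun_finite => -[i j]; rewrite /b/= /closer.
apply: measurable_or; first by apply: measurable_fun_ltr; exact: is_norm_dist_measurable.
apply: measurable_and; last exact: measurable_cst.
by apply: measurable_fun_eqr; exact: is_norm_dist_measurable.
Qed.

Lemma nn_weight_bmf k m n (x x' : nat -> T -> 'rV[R]_d) j :
  (forall i, measurable_fun setT (x i)) -> (forall i, measurable_fun setT (x' i)) ->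
  bounded_measurable
    (fun w => m%:R^-1 * knn_weight N k m n (x ^~ w) (x' ^~ w) j).
Proof.
move=> mx mx'; apply: bmfM; first exact: bmf_cst.
apply: bmfM; first exact: bmf_cst.
apply: bmf_sum => i; apply: bmf_sum => l; apply: bmf_bool.
apply: measurable_fun_eqn; first exact: measurable_cst.
exact: nn_measurable.
Qed.

End Measurability.
End NearestNeighbourFacts.

(** * Independent sequences *)

Section MutualIndependence.
Context dT (T : measurableType dT) (R : realType) (P : probability T R).

Lemma mutually_independent2 (I : choiceType) (F : I -> set (set T)) (i j : I)
    (A B : set T) : mutually_independent P F -> i != j -> F i A -> F j B ->
  P (A `&` B) = (P A * P B)%E.
Proof.
move=> indF ij FA FB.
pose G a := if a == i then A else B.
have Gi : G i = A by rewrite /G eqxx.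
have Gj : G j = B by rewrite /G eq_sym (negPf ij).
have := indF [fset i; j]%fset G.
rewrite big_fsetU1 ?inE//= big_seq_fset1 Gi Gj => <-.
  congr (P _); apply/seteqP; split=> w /=.
    by move=> [Aw Bw] a; rewrite /= !inE => /orP[/eqP->|/eqP->]; rewrite ?Gi ?Gj.
  move=> H; split.
  - by rewrite -Gi; apply: H; rewrite /= !inE eqxx.
  - by rewrite -Gj; apply: H; rewrite /= !inE eqxx orbT.
by move=> a; rewrite !inE => /orP[/eqP->|/eqP->]; rewrite ?Gi ?Gj.
Qed.

Lemma mutually_independent3 (I : choiceType) (F : I -> set (set T)) (i j l : I)
    (A B C : set T) : mutually_independent P F -> i != j -> i != l -> j != l ->
  F i A -> F j B -> F l C ->
  P (A `&` B `&` C) = (P A * P B * P C)%E.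
Proof.
move=> indF ij il jl FA FB FC.
pose G a := if a == i then A else if a == j then B else C.
have Gi : G i = A by rewrite /G eqxx.
have Gj : G j = B by rewrite /G eq_sym (negPf ij) eqxx.
have Gl : G l = C by rewrite /G eq_sym (negPf il) eq_sym (negPf jl).
have := indF [fset i; j; l]%fset G.
rewrite -fsetUA !big_fsetU1 ?inE ?negb_or ?ij ?il ?jl//= big_seq_fset1 Gi Gj Gl.
rewrite muleA => <-.
  congr (P _); apply/seteqP; split=> w /=.
    move=> [[Aw Bw] Cw] a; rewrite /= !inE.
    by move=> /or3P[/eqP->|/eqP->|/eqP->]; rewrite ?Gi ?Gj ?Gl.
  move=> H; split; first split.
  - by rewrite -Gi; apply: H; rewrite /= !inE eqxx.
  - by rewrite -Gj; apply: H; rewrite /= !inE eqxx orbT.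
  - by rewrite -Gl; apply: H; rewrite /= !inE eqxx !orbT.
by move=> a; rewrite !inE => /or3P[/eqP->|/eqP->|/eqP->]; rewrite ?Gi ?Gj ?Gl.
Qed.

Context dV (V : measurableType dV).

Lemma sigma_rv_preimage (X : {RV P >-> V}) (A : set V) :
  measurable A -> sigma_rv X (X @^-1` A).
Proof. by move=> mA; exists A => //; rewrite setTI. Qed.

Lemma sigma_seq_preimage (X_ : nat -> {RV P >-> V}) i (A : set V) :
  measurable A -> sigma_seq X_ (X_ i @^-1` A).
Proof.
move=> mA; apply: sub_sigma_algebra; exists i => //; exact: sigma_rv_preimage.
Qed.

Lemma sigma_seqI (X_ : nat -> {RV P >-> V}) (A B : set T) :
  sigma_seq X_ A -> sigma_seq X_ B -> sigma_seq X_ (A `&` B).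
Proof.
exact: (@measurableI _ (g_sigma_algebraType (\bigcup_i sigma_rv (X_ i)))).
Qed.

Lemma sigma_seq_measurable (X_ : nat -> {RV P >-> V}) :
  sigma_seq X_ `<=` measurable.
Proof.
apply: smallest_sub; first exact: sigma_algebra_measurable.
move=> _ [i _ [A mA <-]]; rewrite setTI; apply: preimage_measurable => //.
Qed.

Lemma iid_indep (X_ : nat -> {RV P >-> V}) (mu : probability V R) i j
    (A B : set V) : iid X_ mu -> i != j -> measurable A -> measurable B ->
  P (X_ i @^-1` A `&` X_ j @^-1` B) = (P (X_ i @^-1` A) * P (X_ j @^-1` B))%E.
Proof.
move=> [ind _] ij mA mB.
by apply: (mutually_independent2 ind ij); exact: sigma_rv_preimage.
Qed.

End MutualIndependence.

Section ThreeSequences.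
Context dT (T : measurableType dT) (R : realType) (P : probability T R).
Context d1 (V1 : measurableType d1) d2 (V2 : measurableType d2)
  d3 (V3 : measurableType d3).
Variables (X_ : nat -> {RV P >-> V1}) (Y_ : nat -> {RV P >-> V2})
  (Z_ : nat -> {RV P >-> V3}).
Variables (muY : probability V2 R) (muZ : probability V3 R).
Hypothesis iidY : iid Y_ muY.
Hypothesis iidZ : iid Z_ muZ.
Hypothesis hindep : mutually_independent P
  (tnth [tuple sigma_seq X_; sigma_seq Y_; sigma_seq Z_]).

Let indXY A B : sigma_seq X_ A -> sigma_seq Y_ B -> P (A `&` B) = (P A * P B)%E.
Proof.
by move=> hA hB; apply: (@mutually_independent2 _ _ _ _ _ _
  (@Ordinal 3 0 isT) (@Ordinal 3 1 isT) _ _ hindep).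
Qed.

Let indXYZ A B C : sigma_seq X_ A -> sigma_seq Y_ B -> sigma_seq Z_ C ->
  P (A `&` B `&` C) = (P A * P B * P C)%E.
Proof.
by move=> hA hB hC; apply: (@mutually_independent3 _ _ _ _ _ _
  (@Ordinal 3 0 isT) (@Ordinal 3 1 isT) (@Ordinal 3 2 isT) _ _ _ hindep).
Qed.

(** Two factorizations on rectangles: the event on [X_ i] splits off by independence of the
    sequences, then those on [Y_ j] and [Y_ l] separate because [Y_] is i.i.d. Meant for two sample
    points tested against the same random ball. *)
Lemma indep_XYY_Rintegral_eq0 i j l (h : (V1 * V2) * V2 -> R) : j != l ->
  bounded_measurable h ->
  (forall u, \int[P]_w h (u, Y_ l w) = 0) ->
  \int[P]_w h ((X_ i w, Y_ j w), Y_ l w) = 0.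
Proof.
move=> jl bh h0.
apply: (@indep_Rintegral_eq0 _ _ _ P _ _ _ _ (fun w => (X_ i w, Y_ j w)) (Y_ l)) => //.
  exact: measurable_fun_pair.
move=> S C mS mC.
apply: indep_pair_rectangle => //; first exact: preimage_measurable.
move=> A B mA mB.
rewrite -setIA indXY; last 2 first.
- exact: sigma_seq_preimage.
- by apply: sigma_seqI; exact: sigma_seq_preimage.
rewrite (iid_indep iidY)// muleA; congr (_ * _)%E.
by apply/esym/indXY; exact: sigma_seq_preimage.
Qed.

(* The pair (X, Y) of whole sequences is encoded as the diagonal of Omega seen
   in the product of (Omega, sigma(X)) and (Omega, sigma(Y)). *)
Let GX := g_sigma_algebraType (\bigcup_i sigma_rv (X_ i)).
Let GY := g_sigma_algebraType (\bigcup_i sigma_rv (Y_ i)).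

Lemma sigma_seq_measurable_fun dV (V : measurableType dV)
    (U_ : nat -> {RV P >-> V}) i :
  measurable_fun setT
    (U_ i : g_sigma_algebraType (\bigcup_i sigma_rv (U_ i)) -> V).
Proof. by move=> _ A mA; rewrite setTI; exact: sigma_seq_preimage. Qed.

(** Meant for the noise: weights see both whole sequences, so these are frozen together with [Z_ j]
    and only [Z_ l] is integrated. Independence is built in two layers, first the diagonal pair
    against [sigma_seq Z_], then the same pair extended by [Z_ j]. *)
Lemma indep_XYZZ_Rintegral_eq0 j l (h : ((GX * GY) * V3) * V3 -> R) : j != l ->
  bounded_measurable h ->
  (forall u, \int[P]_w h (u, Z_ l w) = 0) ->
  \int[P]_w h (((w, w), Z_ j w), Z_ l w) = 0.
Proof.
move=> jl bh h0.
(* The target carries a coarser sigma-algebra on the same set. *)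
have mX : measurable_fun setT (idfun : T -> GX).
  by move=> _ A mA; rewrite setTI; exact: (sigma_seq_measurable mA).
have mY : measurable_fun setT (idfun : T -> GY).
  by move=> _ A mA; rewrite setTI; exact: (sigma_seq_measurable mA).
have mXY : measurable_fun setT (fun w : T => (w, w) : GX * GY).
  exact: (measurable_fun_pair mX mY).
have step S (C : set T) : measurable S -> sigma_seq Z_ C ->
    P ((fun w : T => (w, w) : GX * GY) @^-1` S `&` C) =
    (P ((fun w : T => (w, w) : GX * GY) @^-1` S) * P C)%E.
  move=> mS hC; apply: (indep_pair_rectangle mX mY) => //.
    exact: sigma_seq_measurable hC.
  by move=> A B mA mB; rewrite indXYZ// indXY.
apply: (@indep_Rintegral_eq0 _ _ _ P _ _ _ _
  (fun w => ((w, w) : GX * GY, Z_ j w)) (Z_ l)) => //.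
  exact: measurable_fun_pair.
move=> S C mS mC.
apply: (indep_pair_rectangle mXY) => //; first exact: preimage_measurable.
move=> A B mA mB.
rewrite -setIA step//; last by apply: sigma_seqI; exact: sigma_seq_preimage.
rewrite (iid_indep iidZ)// muleA; congr (_ * _)%E.
by apply/esym/step => //; exact: sigma_seq_preimage.
Qed.

End ThreeSequences.

(** * The three error terms *)

Lemma sum_nn_weight (R : realType) (d : nat) (N : 'rV[R]_d -> R) (k m n : nat)
    (x x' : nat -> 'rV[R]_d) : (0 < n)%N -> (0 < k <= m)%N ->
  \sum_(j < m) m%:R^-1 * knn_weight N k m n x x' j = 1.
Proof.
move=> n0 /andP[k0 km]; have m0 := leq_trans k0 km.
have := sum_nn_weight_mul N n x x' (fun _ => 1) m0 km.
under eq_bigr do rewrite mulr1.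
move=> ->; rewrite !(sumr_const, card_ord).
by rewrite -(mulr_natr _ n) mulVf ?mul1r ?mulVf// pnatr_eq0 -lt0n.
Qed.

Section KnnError.
Context (R : realType) (d e : nat) (N : 'rV[R]_d -> R).
Hypothesis hN : is_norm N.
Context (dTh : measure_display) (Th : measurableType dTh).
Variables (f : 'rV[R]_d * Th -> 'rV[R]_e) (phi : 'rV[R]_e -> R).
Hypotheses (mf : measurable_fun setT f) (mphi : measurable_fun setT phi).
Variables (muX muX' : probability 'rV[R]_d R) (muTh : probability Th R).
Context (dO : measure_display) (Omega : measurableType dO).
Variables (P : probability Omega R) (Theta : {RV P >-> Th}).
Hypothesis hTheta : has_law Theta muTh.
Variables (X_ X'_ : nat -> {RV P >-> 'rV[R]_d}) (Theta_ : nat -> {RV P >-> Th}).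
Hypotheses (hX_ : iid X_ muX) (hX'_ : iid X'_ muX') (hTheta_ : iid Theta_ muTh).
Hypothesis hindep : mutually_independent P
  (tnth [tuple sigma_seq X_; sigma_seq X'_; sigma_seq Theta_]).
Variable psi : 'rV[R]_d -> R.
Hypothesis hpsi : forall x, psi x = fine 'E_P[fun w => phi (f (x, Theta w))].
Variable M : R.
Hypothesis hM : forall y, `|phi y| <= M.
Variable L : R.
Hypothesis hL : forall x y, `|psi x - psi y| <= L * N (x - y).

Let bphif : bounded_measurable (fun z => phi (f z)).
Proof. by split; [exact: (measurableT_comp mphi mf)|exists M => z; exact: hM]. Qed.

Let bphifx x : bounded_measurable (fun t => phi (f (x, t))).
Proof. exact: (bmf_comp bphif (measurable_pair1 x)). Qed.

Lemma psi_Rintegral x : psi x = \int[P]_w phi (f (x, Theta w)).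
Proof.
by rewrite hpsi bmf_expectation//; apply: (bmf_comp (bphifx x)).
Qed.

Lemma psi_normr_le x : `|psi x| <= M.
Proof.
have b : bounded_measurable (fun w => phi (f (x, Theta w))).
  exact: (bmf_comp (bphifx x)).
rewrite psi_Rintegral ler_norml; apply/andP; split.
  rewrite -[leLHS](Rintegral_prob_cst P); apply: bmf_le_Rintegral => //.
    exact: bmf_cst.
  by move=> w; have := hM (f (x, Theta w)); rewrite ler_norml => /andP[].
apply: bmf_Rintegral_le_cst => // w.
by have := hM (f (x, Theta w)); rewrite ler_norml => /andP[].
Qed.

Let M_ge0 : 0 <= M. Proof. exact: le_trans (normr_ge0 _) (psi_normr_le 0). Qed.

(** Measurability is read off the Lipschitz bound rather than from Fubini. *)
Lemma psi_bmf : bounded_measurable psi.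
Proof.
by split; [exact: (is_norm_lipschitz_measurable hN hL)|exists M; exact: psi_normr_le].
Qed.

(** [psi] is an average over [Theta]; equality of laws carries it over to each [Theta_ j]. *)
Lemma phi_psi_centered j x : \int[P]_w (phi (f (x, Theta_ j w)) - psi x) = 0.
Proof.
have b (U : {RV P >-> Th}) : bounded_measurable (fun w => phi (f (x, U w))).
  exact: (bmf_comp (bphifx x)).
rewrite bmf_RintegralB_cst// psi_Rintegral.
have [_ lawT] := hTheta_.
rewrite (has_law_Rintegral (lawT j) (bphifx x)).
by rewrite (has_law_Rintegral hTheta (bphifx x)) subrr.
Qed.

Let c k m n j w : R := m%:R^-1 * knn_weight N k m n (X_ ^~ w) (X'_ ^~ w) j.
Let xi j w : R := phi (f (X'_ j w, Theta_ j w)) - psi (X'_ j w).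

Let bc k m n j : bounded_measurable (c k m n j).
Proof. by apply: nn_weight_bmf. Qed.

Let bxi j : bounded_measurable (xi j).
Proof.
apply: bmfB; last exact: bmf_comp psi_bmf _.
exact: (bmf_comp bphif (measurable_fun_pair _ _)).
Qed.

Let xi_normr_le j w : `|xi j w| <= 2 * M.
Proof.
rewrite (le_trans (ler_normB _ _))// mulr_natl mulr2n lerD//.
exact: psi_normr_le.
Qed.

(** With both samples frozen, the weights are constants and the noises are independent and centred,
    so all cross terms vanish. *)
Lemma noise_second_moment k m n : (0 < n)%N -> (0 < k <= m)%N ->
  \int[P]_w ((\sum_(j < m) c k m n j w * xi j w) ^+ 2) <= 4 * M ^+ 2 / k%:R.
Proof.
move=> n0 km0; have /andP[k0 km] := km0; have m0 := leq_trans k0 km.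
have bF (j : 'I_m) : bounded_measurable (fun w => c k m n j w * xi j w).
  by apply: bmfM; [exact: bc|exact: bxi].
rewrite Rintegral_sqr_sum_orthogonal//; last first.
  move=> j l jl.
  pose GX := g_sigma_algebraType (\bigcup_i sigma_rv (X_ i)).
  pose GY := g_sigma_algebraType (\bigcup_i sigma_rv (X'_ i)).
  (* The queries are read on one copy of [Omega] and the sample on another, so that the weights are
     measurable for the product of the two generated sigma-algebras; the diagonal gives back the
     true weights. *)
  pose w_ (i : nat) (z : GX * GY) : R :=
    m%:R^-1 * knn_weight N k m n (X_ ^~ z.1) (X'_ ^~ z.2) i.
  have mX i : measurable_fun setT (fun z : GX * GY => X_ i z.1).
    exact: (measurableT_comp (@sigma_seq_measurable_fun _ _ _ P _ _ X_ i)).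
  have mY i : measurable_fun setT (fun z : GX * GY => X'_ i z.2).
    exact: (measurableT_comp (@sigma_seq_measurable_fun _ _ _ P _ _ X'_ i)).
  have bw i : bounded_measurable (w_ i).
    exact: (@nn_weight_bmf _ _ _ _ (GX * GY)%type hN k m n
      (fun i (z : GX * GY) => X_ i z.1) (fun i (z : GX * GY) => X'_ i z.2)
      i mX mY).
  pose h (z : ((GX * GY) * Th) * Th) : R :=
    (w_ j z.1.1 * (phi (f (X'_ j z.1.1.2, z.1.2)) - psi (X'_ j z.1.1.2))) *
    (w_ l z.1.1 * (phi (f (X'_ l z.1.1.2, z.2)) - psi (X'_ l z.1.1.2))).
  apply: (indep_XYZZ_Rintegral_eq0 (j := j) (l := l) (h := h) hTheta_ hindep) => //.
  - have mYz i : measurable_fun setT (fun z : ((GX * GY) * Th) * Th => X'_ i z.1.1.2).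
      exact: (measurableT_comp (mY i)
        (measurableT_comp measurable_fst measurable_fst)).
    apply: bmfM; apply: bmfM.
    + exact: (bmf_comp (bw j) (measurableT_comp measurable_fst measurable_fst)).
    + apply: bmfB; last exact: (bmf_comp psi_bmf (mYz j)).
      apply: (bmf_comp bphif (measurable_fun_pair (mYz j) _)).
      exact: (measurableT_comp measurable_snd measurable_fst).
    + exact: (bmf_comp (bw l) (measurableT_comp measurable_fst measurable_fst)).
    + apply: bmfB; last exact: (bmf_comp psi_bmf (mYz l)).
      exact: (bmf_comp bphif (measurable_fun_pair (mYz l) measurable_snd)).
  - move=> [z t] /=; rewrite /h/=.
    under eq_Rintegral do rewrite mulrA.
    rewrite bmf_RintegralZ ?phi_psi_centered ?mulr0//.
    apply: bmfB; last exact: bmf_cst.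
    exact: (bmf_comp (bphifx (X'_ l z.2))).
rewrite -bmf_Rintegral_sum; last by move=> j; exact: bmfX.
apply: bmf_Rintegral_le_cst; first by apply: bmf_sum => j; exact: bmfX.
move=> w.
(* In each squared weight one factor is bounded by [1 / k]; the other is kept, so that the weights
   still sum to 1. *)
apply: (@le_trans _ _ (\sum_(j < m) 4 * M ^+ 2 / k%:R * c k m n j w)); last first.
  by rewrite -mulr_sumr sum_nn_weight// mulr1.
apply: ler_sum => j _; have c0 : 0 <= c k m n j w := nn_weight_ge0 N k m n _ _ j.
have ck : c k m n j w <= k%:R^-1 := nn_weight_le N _ _ j m0 n0 km0.
have xi2 : xi j w ^+ 2 <= 4 * M ^+ 2.
  rewrite -real_normK ?num_real// (_ : 4 * M ^+ 2 = (2 * M) ^+ 2); last by ring.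
  by rewrite lerXn2r ?nnegrE ?mulr_ge0.
rewrite exprMn expr2 -mulrA mulrC.
by rewrite ler_wpM2r// mulrC ler_pM// sqr_ge0.
Qed.

Lemma psi_mean_second_moment (q : R) n : (0 < n)%N -> q = \int[muX]_x psi x ->
  \int[P]_w ((n%:R^-1 * \sum_(i < n) psi (X_ i w) - q) ^+ 2) <= 4 * M ^+ 2 / n%:R.
Proof.
move=> n0 qE; have nr : (n%:R : R) != 0 by rewrite pnatr_eq0 -lt0n.
have bF (i : nat) : bounded_measurable (fun w => psi (X_ i w) - q).
  by apply: bmfB; [exact: (bmf_comp psi_bmf)|exact: bmf_cst].
have F0 i : \int[P]_w (psi (X_ i w) - q) = 0.
  rewrite bmf_RintegralB_cst; last exact: (bmf_comp psi_bmf).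
  by rewrite (has_law_Rintegral (hX_.2 i) psi_bmf) qE subrr.
have q_le : `|q| <= M.
  rewrite qE ler_norml; apply/andP; split.
    rewrite -[leLHS](Rintegral_prob_cst muX); apply: bmf_le_Rintegral.
    - exact: bmf_cst.
    - exact: psi_bmf.
    - by move=> x; have := psi_normr_le x; rewrite ler_norml => /andP[].
  apply: bmf_Rintegral_le_cst; first exact: psi_bmf.
  by move=> x; have := psi_normr_le x; rewrite ler_norml => /andP[].
under eq_Rintegral => w _.
  rewrite (_ : _ - q = n%:R^-1 * \sum_(i < n) (psi (X_ i w) - q)); last first.
    rewrite big_split/= sumr_const card_ord -(mulr_natl (- q)) mulrDr.
    by rewrite mulrA mulVf// mul1r.
  rewrite exprMn.
  over.
have bS : bounded_measurable (fun w => \sum_(i < n) (psi (X_ i w) - q)).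
  by apply: bmf_sum => i; exact: bF.
rewrite bmf_RintegralZ; last exact: bmfX.
rewrite Rintegral_sqr_sum_orthogonal//; last first.
  move=> i j ij; pose h (z : 'rV[R]_d * 'rV[R]_d) := (psi z.1 - q) * (psi z.2 - q).
  apply: (indep_Rintegral_eq0 (U := X_ i) (W := X_ j) (h := h)) => //.
  - apply: bmfM; (apply: bmfB; last exact: bmf_cst).
    + exact: (bmf_comp psi_bmf measurable_fst).
    + exact: (bmf_comp psi_bmf measurable_snd).
  - by move=> A B mA mB; exact: (iid_indep hX_).
  - by move=> u; rewrite /h/= bmf_RintegralZ ?F0 ?mulr0.
apply: (@le_trans _ _ (n%:R^-1 ^+ 2 * \sum_(i < n) (4 * M ^+ 2))); last first.
  rewrite sumr_const card_ord -[_ *+ n]mulr_natr expr2.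
  by rewrite le_eqVlt; apply/orP; left; apply/eqP; field.
rewrite ler_wpM2l ?sqr_ge0//; apply: ler_sum => i _.
apply: bmf_Rintegral_le_cst; first exact: bmfX.
move=> w; rewrite -real_normK ?num_real// (_ : 4 * M ^+ 2 = (2 * M) ^+ 2); last by ring.
rewrite lerXn2r ?nnegrE ?mulr_ge0// (le_trans (ler_normB _ _))//.
by rewrite mulr_natl mulr2n lerD// psi_normr_le.
Qed.

(** * Number of sample points in a ball around a query point *)

Section Balls.
Variable eps : R.

Definition ball_mass (x : 'rV[R]_d) : R := fine (muX' [set x' | N (x - x') <= eps]).

Definition ball_count (m i : nat) (w : Omega) : R :=
  \sum_(j < m) (N (X_ i w - X'_ j w) <= eps)%R%:R.

Lemma norm_sub_le_bmf dT (T : measurableType dT) (U V : T -> 'rV[R]_d) :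
  measurable_fun setT U -> measurable_fun setT V ->
  bounded_measurable (fun w => (N (U w - V w) <= eps)%R%:R : R).
Proof.
move=> mU mV; apply: bmf_bool; apply: measurable_fun_ler.
  exact: is_norm_dist_measurable.
exact: measurable_cst.
Qed.

Lemma ball_mass_ge0 x : 0 <= ball_mass x.
Proof. exact: fine_ge0. Qed.

Lemma ball_mass_le1 x : ball_mass x <= 1.
Proof.
rewrite -[leRHS]/(fine 1%E) fine_le//.
  by apply: fin_num_measure; exact: is_norm_ball_measurable.
by apply: probability_le1; exact: is_norm_ball_measurable.
Qed.

(** The mass is that of a section of the closed tube around the diagonal, so the measurability of
    section measures applies. *)
Lemma ball_mass_measurable : measurable_fun setT ball_mass.
Proof.
pose A : set ('rV[R]_d * 'rV[R]_d) := [set z | N (z.1 - z.2) <= eps].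
have mA : measurable A.
  have m : measurable_fun setT (fun z : 'rV[R]_d * 'rV[R]_d => N (z.1 - z.2)).
    exact: (is_norm_dist_measurable hN measurable_fst measurable_snd).
  rewrite [X in measurable X](_ : _ =
      (fun z : 'rV[R]_d * 'rV[R]_d => N (z.1 - z.2)) @^-1` `]-oo, eps]).
    by rewrite -[X in measurable X]setTI; exact: (m measurableT _ (measurable_itv _)).
  by apply/seteqP; split=> z /=; rewrite in_itv.
have := measurable_fun_xsection muX' mA.
move=> /(measurableT_comp (fine_measurable measurableT)).
rewrite (_ : _ \o _ = ball_mass)//.
apply/funext => x /=; rewrite /ball_mass; congr (fine (muX' _)).
by apply/seteqP; split=> y /=; rewrite /xsection/= in_setE.
Qed.

Lemma ball_mass_bmf : bounded_measurable ball_mass.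
Proof.
split; first exact: ball_mass_measurable.
by exists 1 => x; rewrite ger0_norm ?ball_mass_ge0// ball_mass_le1.
Qed.

(** Given [X_ i], the count is binomial with [m] trials and success probability
    [ball_mass (X_ i w)]. The centred indicators are orthogonal and bounded by 1, hence the bound
    [m]. *)
Lemma ball_count_second_moment m i :
  \int[P]_w ((ball_count m i w - m%:R * ball_mass (X_ i w)) ^+ 2) <= m%:R.
Proof.
pose F (j : nat) w : R := (N (X_ i w - X'_ j w) <= eps)%R%:R - ball_mass (X_ i w).
have bF j : bounded_measurable (F j).
  by apply: bmfB; [exact: norm_sub_le_bmf|exact: (bmf_comp ball_mass_bmf)].
under eq_Rintegral => w _.
  rewrite (_ : _ - _ = \sum_(j < m) F j w); last first.
    by rewrite big_split/= sumr_const card_ord mulNrn mulr_natl.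
  over.
rewrite Rintegral_sqr_sum_orthogonal//; last first.
  move=> j l jl.
  pose h (z : ('rV[R]_d * 'rV[R]_d) * 'rV[R]_d) : R :=
    ((N (z.1.1 - z.1.2) <= eps)%R%:R - ball_mass z.1.1) *
    ((N (z.1.1 - z.2) <= eps)%R%:R - ball_mass z.1.1).
  have m11 : measurable_fun setT (fun z : ('rV[R]_d * 'rV[R]_d) * 'rV[R]_d => z.1.1).
    exact: (measurableT_comp measurable_fst measurable_fst).
  have m12 : measurable_fun setT (fun z : ('rV[R]_d * 'rV[R]_d) * 'rV[R]_d => z.1.2).
    exact: (measurableT_comp measurable_snd measurable_fst).
  apply: (indep_XYY_Rintegral_eq0 (j := j) (l := l) (h := h) hX'_ hindep i) => //.
  - apply: bmfM; (apply: bmfB; last exact: (bmf_comp ball_mass_bmf m11)).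
    + exact: norm_sub_le_bmf.
    + exact: (norm_sub_le_bmf m11 measurable_snd).
  - move=> [x y]; rewrite /h/=.
    have bx : bounded_measurable (fun z : 'rV[R]_d => (N (x - z) <= eps)%R%:R : R).
      exact: (norm_sub_le_bmf (measurable_cst x) (@measurable_id _ _ setT)).
    have bxl : bounded_measurable (fun w => (N (x - X'_ l w) <= eps)%R%:R : R).
      exact: (bmf_comp bx).
    rewrite bmf_RintegralZ; last by apply: bmfB => //; exact: bmf_cst.
    rewrite bmf_RintegralB_cst// (has_law_Rintegral (hX'_.2 l) bx) Rintegral_bool.
      by rewrite subrr mulr0.
    apply: measurable_fun_ler; last exact: measurable_cst.
    exact: (is_norm_dist_measurable hN (measurable_cst x) (@measurable_id _ _ setT)).
apply: (@le_trans _ _ (\sum_(j < m) (1 : R))); last by rewrite sumr_const card_ord.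
apply: ler_sum => j _; apply: bmf_Rintegral_le_cst; first exact: bmfX.
move=> w; rewrite -real_normK ?num_real// expr_le1// ler_norml /F.
have := ball_mass_ge0 (X_ i w); have := ball_mass_le1 (X_ i w).
by case: (_ <= eps) => /=; lra.
Qed.

(* Chebyshev: fewer than k points in the ball forces the ball to have small mass,
   or the count to deviate from its conditional mean by at least m delta / 2. *)
Lemma ball_count_lt_mean (k m i : nat) (delta : R) :
  (0 < m)%N -> 0 < delta -> k%:R <= m%:R * delta / 2 ->
  \int[P]_w (ball_count m i w < k%:R)%R%:R <=
    fine (muX [set x | ball_mass x <= delta]) + 4 / (m%:R * delta ^+ 2).
Proof.
move=> m0 delta0 km.
have mr : (0 : R) < m%:R by rewrite ltr0n.
have bcount : bounded_measurable (ball_count m i).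
  by apply: bmf_sum => j; exact: norm_sub_le_bmf.
have bdev : bounded_measurable
    (fun w => (ball_count m i w - m%:R * ball_mass (X_ i w)) ^+ 2).
  apply: bmfX; apply: bmfB => //; apply: bmfM; first exact: bmf_cst.
  exact: (bmf_comp ball_mass_bmf).
have msmall : measurable_fun setT (fun x => ball_mass x <= delta).
  by apply: measurable_fun_ler; [exact: ball_mass_measurable|exact: measurable_cst].
have bsmall := bmf_bool R msmall.
have bsmallX : bounded_measurable (fun w => (ball_mass (X_ i w) <= delta)%R%:R : R).
  exact: (bmf_comp bsmall).
(* Inverse square of the deviation threshold [m * delta / 2]: the term with factor [a] is at least 1
   as soon as the deviation reaches it. *)
pose a : R := 4 / (m%:R * delta) ^+ 2.
have a0 : 0 <= a by rewrite divr_ge0// sqr_ge0.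
apply: (@le_trans _ _ (\int[P]_w ((ball_mass (X_ i w) <= delta)%R%:R +
    a * (ball_count m i w - m%:R * ball_mass (X_ i w)) ^+ 2))).
  apply: bmf_le_Rintegral.
  - apply: bmf_bool; apply: measurable_fun_ltr; last exact: measurable_cst.
    by case: bcount.
  - by apply: bmfD => //; apply: bmfM => //; exact: bmf_cst.
  move=> w; case: (leP (ball_mass _) delta) => /= [_|dm].
    apply: (@le_trans _ _ 1); first by case: (_ < _).
    by rewrite lerDl mulr_ge0// sqr_ge0.
  rewrite add0r; case: ltP => /= [ck|_]; last by rewrite mulr_ge0// sqr_ge0.
  (* The conditional mean exceeds [m * delta], while the count, being below [k], is less than half
     of that. *)
  have md : m%:R * delta / 2 <= m%:R * ball_mass (X_ i w) - ball_count m i w.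
    have : m%:R * delta < m%:R * ball_mass (X_ i w) by rewrite ltr_pM2l.
    lra.
  rewrite /a mulrAC ler_pdivlMr ?mul1r ?exprn_gt0 ?mulr_gt0//.
  rewrite -subr_ge0 -sqrrN opprB.
  have mdp : 0 <= m%:R * delta / 2 by rewrite divr_ge0// mulr_ge0// ltW.
  have : (m%:R * delta / 2) ^+ 2 <=
         (m%:R * ball_mass (X_ i w) - ball_count m i w) ^+ 2.
    by rewrite lerXn2r ?nnegrE// (le_trans mdp).
  by rewrite expr_div_n subr_ge0 ler_pdivrMr//; lra.
rewrite bmf_RintegralD//; last by apply: bmfM => //; exact: bmf_cst.
apply: lerD.
  by rewrite (has_law_Rintegral (hX_.2 i) bsmall) Rintegral_bool.
rewrite bmf_RintegralZ//.
apply: le_trans (ler_wpM2l a0 (ball_count_second_moment m i)) _.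
rewrite le_eqVlt; apply/orP; left; apply/eqP; rewrite /a; field.
by rewrite !gt_eqF.
Qed.

End Balls.

(** Having two bounds lets one be the crude constant [2 * M] and the other a small one, so that a
    first moment controls the second. *)
Lemma sqr_normr_le (a A B : R) : `|a| <= A -> `|a| <= B -> a ^+ 2 <= A * B.
Proof. by move=> aA aB; rewrite -real_normK ?num_real// expr2 ler_pM. Qed.

Lemma normr_mean_le n (a b : nat -> R) : (forall i, `|a i| <= b i) ->
  `|n%:R^-1 * \sum_(i < n) a i| <= n%:R^-1 * \sum_(i < n) b i.
Proof.
move=> ab; rewrite normrM ger0_norm ?invr_ge0// ler_wpM2l ?invr_ge0//.
by apply: le_trans (ler_norm_sum _ _ _) _; apply: ler_sum.
Qed.

Lemma mean_cst n (a : R) : (0 < n)%N -> n%:R^-1 * \sum_(i < n) a = a.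
Proof.
move=> n0; rewrite sumr_const card_ord -(mulr_natl a) mulrA mulVf ?mul1r//.
by rewrite pnatr_eq0 -lt0n.
Qed.

(** For each query, either its [k] neighbours all lie within [eps] and the Lipschitz bound applies,
    or the ball is underpopulated and [2 * M] is paid on an event of small probability. *)
Lemma bias_second_moment (eps delta : R) k m n : 0 <= eps -> 0 < delta ->
  (0 < n)%N -> (0 < k <= m)%N -> k%:R <= m%:R * delta / 2 ->
  \int[P]_w ((\sum_(j < m) c k m n j w * psi (X'_ j w) -
      n%:R^-1 * \sum_(i < n) psi (X_ i w)) ^+ 2) <=
  2 * M * (`|L| * eps + 2 * M *
    (fine (muX [set x | ball_mass eps x <= delta]) + 4 / (m%:R * delta ^+ 2))).
Proof.
move=> eps0 delta0 n0 /andP[k0 km] kmd; have m0 := leq_trans k0 km.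
pose D (i : nat) w : R := k%:R^-1 *
  \sum_(l < k) (psi (X'_ (nn N m (X'_ ^~ w) (X_ i w) l) w) - psi (X_ i w)).
pose b (i : nat) w : R := `|L| * eps + 2 * M * (ball_count eps m i w < k%:R)%R%:R.
have biasE w : \sum_(j < m) c k m n j w * psi (X'_ j w) -
    n%:R^-1 * \sum_(i < n) psi (X_ i w) = n%:R^-1 * \sum_(i < n) D i w.
  rewrite /c (sum_nn_weight_mul N n _ _ (fun j => psi (X'_ j w)) m0 km).
  rewrite -mulrBr -sumrB; congr (_ * _); apply: eq_bigr => i _.
  by rewrite /D sumrB mulrBr mean_cst.
have psiB x y : `|psi x - psi y| <= 2 * M.
  by rewrite (le_trans (ler_normB _ _))// mulr_natl mulr2n lerD// psi_normr_le.
have D2M i w : `|D i w| <= 2 * M.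
  rewrite -[leRHS](mean_cst _ k0); apply: (@normr_mean_le k
    (fun l => psi (X'_ (nn N m (X'_ ^~ w) (X_ i w) l) w) - psi (X_ i w))
    (fun=> 2 * M)) => l.
  exact: psiB.
have Db i w : `|D i w| <= b i w.
  rewrite /b; case: ltP => /= [_|kS].
    by rewrite mulr1 (le_trans (D2M i w))// lerDr mulr_ge0.
  rewrite mulr0 addr0 -[leRHS](mean_cst _ k0) /D.
  rewrite normrM ger0_norm ?invr_ge0// ler_wpM2l ?invr_ge0//.
  apply: le_trans (ler_norm_sum _ _ _) _; apply: ler_sum => l _.
  apply: le_trans (hL _ _) _.
  have close : N (X_ i w - X'_ (nn N m (X'_ ^~ w) (X_ i w) l) w) <= eps.
    apply: (@nn_dist_le _ _ N m k (X'_ ^~ w)); first exact: ltn_ord.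
    by move: kS; rewrite /ball_count -natr_sum ler_nat.
  rewrite (is_normC hN); apply: le_trans (ler_wpM2l (normr_ge0 L) close).
  by rewrite ler_wpM2r ?ler_norm// is_norm_ge0.
have bb i : bounded_measurable (b i).
  apply: bmfD; first exact: bmf_cst.
  apply: bmfM; first exact: bmf_cst.
  apply: bmf_bool; apply: measurable_fun_ltr; last exact: measurable_cst.
  have : bounded_measurable (ball_count eps m i).
    by apply: bmf_sum => j; exact: norm_sub_le_bmf.
  by case.
have bpsi (X : {RV P >-> 'rV[R]_d}) : bounded_measurable (fun w => psi (X w)).
  exact: (bmf_comp psi_bmf).
apply: (@le_trans _ _ (\int[P]_w (2 * M * (n%:R^-1 * \sum_(i < n) b i w)))).
  apply: bmf_le_Rintegral.
  - apply: bmfX; apply: bmfB; last by apply: bmfM; [exact: bmf_cst|exact: bmf_sum].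
    by apply: bmf_sum => j; exact: bmfM.
  - apply: bmfM; first exact: bmf_cst.
    by apply: bmfM; [exact: bmf_cst|exact: bmf_sum].
  move=> w; rewrite biasE; apply: sqr_normr_le.
    rewrite -[leRHS](mean_cst _ n0).
    exact: (normr_mean_le n (fun i => D2M i w)).
  exact: (normr_mean_le n (fun i => Db i w)).
rewrite bmf_RintegralZ; last by apply: bmfM; [exact: bmf_cst|exact: bmf_sum].
rewrite ler_wpM2l ?mulr_ge0// bmf_RintegralZ ?bmf_Rintegral_sum//; last exact: bmf_sum.
rewrite -[leRHS](mean_cst _ n0) ler_wpM2l ?invr_ge0//; apply: ler_sum => i _.
have bind : bounded_measurable (fun w => (ball_count eps m i w < k%:R)%R%:R : R).
  apply: bmf_bool; apply: measurable_fun_ltr; last exact: measurable_cst.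
  have : bounded_measurable (ball_count eps m i).
    by apply: bmf_sum => j; exact: norm_sub_le_bmf.
  by case.
rewrite bmf_RintegralD ?Rintegral_prob_cst; [|exact: bmf_cst|]; last first.
  by apply: bmfM => //; exact: bmf_cst.
by rewrite lerD2l bmf_RintegralZ// ler_wpM2l ?mulr_ge0// ball_count_lt_mean.
Qed.

Let est k m n w : R :=
  knn_estimator N f phi k m n (X_ ^~ w) (X'_ ^~ w) (Theta_ ^~ w).

Lemma knn_estimator_bmf k m n : bounded_measurable (est k m n).
Proof.
apply: bmfM; first exact: bmf_cst.
apply: bmf_sum => j; apply: bmfM; last first.
  exact: (bmf_comp bphif (measurable_fun_pair _ _)).
(* An index [j : 'I_m] is at hand, so [m] is nonzero and the weight can be recovered as [m] times
   the measurable coefficient [c]. *)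
have m0 : m != 0%N by case: m j => [[]|].
rewrite (_ : (fun w => _) = (fun w => m%:R * c k m n j w)); last first.
  by apply/funext => w; rewrite /c mulrA mulfV ?mul1r// pnatr_eq0.
by apply: bmfM; [exact: bmf_cst|exact: bc].
Qed.

(** The factor 3 comes from the square of a sum of three terms. The parameters [eps] and [delta]
    stay free, to be fixed before [m] and [n] grow. *)
Lemma knn_second_moment (q eps delta : R) k m n : q = \int[muX]_x psi x ->
  0 <= eps -> 0 < delta ->
  (0 < n)%N -> (0 < k <= m)%N -> k%:R <= m%:R * delta / 2 ->
  \int[P]_w ((est k m n w - q) ^+ 2) <=
  3 * (4 * M ^+ 2 / k%:R + 2 * M * (`|L| * eps + 2 * M *
    (fine (muX [set x | ball_mass eps x <= delta]) + 4 / (m%:R * delta ^+ 2))) +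
    4 * M ^+ 2 / n%:R).
Proof.
move=> qE eps0 delta0 n0 km0 kmd.
pose T1 w := \sum_(j < m) c k m n j w * xi j w.
pose T2 w := \sum_(j < m) c k m n j w * psi (X'_ j w) -
  n%:R^-1 * \sum_(i < n) psi (X_ i w).
pose T3 w := n%:R^-1 * \sum_(i < n) psi (X_ i w) - q.
have bpsi (X : {RV P >-> 'rV[R]_d}) : bounded_measurable (fun w => psi (X w)).
  exact: (bmf_comp psi_bmf).
have bmean : bounded_measurable (fun w => n%:R^-1 * \sum_(i < n) psi (X_ i w)).
  by apply: bmfM; [exact: bmf_cst|exact: bmf_sum].
have b1 : bounded_measurable T1 by apply: bmf_sum => j; exact: bmfM.
have b2 : bounded_measurable T2.
  by apply: bmfB => //; apply: bmf_sum => j; exact: bmfM.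
have b3 : bounded_measurable T3 by apply: bmfB => //; exact: bmf_cst.
have estE w : est k m n w - q = T1 w + T2 w + T3 w.
  rewrite /T1 /T2 /T3 /xi /est /knn_estimator.
  under [in RHS]eq_bigr do rewrite mulrBr.
  rewrite sumrB mulr_sumr; under eq_bigr do rewrite mulrA.
  by ring.
apply: (@le_trans _ _ (\int[P]_w (3 * (T1 w ^+ 2 + T2 w ^+ 2 + T3 w ^+ 2)))).
  apply: bmf_le_Rintegral.
  - by apply: bmfX; apply: bmfB; [exact: knn_estimator_bmf|exact: bmf_cst].
  - apply: bmfM; first exact: bmf_cst.
    by apply: bmfD; [apply: bmfD|]; exact: bmfX.
  move=> w; rewrite estE.
  (* The squares of the three differences add up exactly to the gap in the inequality. *)
  have := sqr_ge0 (T1 w - T2 w); have := sqr_ge0 (T1 w - T3 w).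
  by have := sqr_ge0 (T2 w - T3 w); nra.
rewrite bmf_RintegralZ; last by apply: bmfD; [apply: bmfD|]; exact: bmfX.
rewrite ler_wpM2l// !bmf_RintegralD//; try exact: bmfX; last by apply: bmfD; exact: bmfX.
by rewrite !lerD//; [exact: noise_second_moment|exact: bias_second_moment|
  exact: psi_mean_second_moment].
Qed.

(** Continuity from above along [delta = 1 / (n + 1)]: a point in all the sets [F n] has a ball of
    mass 0, so it lies outside the support of [muX'], hence outside that of [muX], whose complement
    is null. *)
Lemma small_ball_mass (eps : R) : 0 < eps -> supp N muX `<=` supp N muX' ->
  forall tau : R, 0 < tau -> exists2 delta : R, 0 < delta &
    fine (muX [set x | ball_mass eps x <= delta]) <= tau.
Proof.
move=> eps0 hsupp tau tau0.
pose F n := [set x | ball_mass eps x <= n.+1%:R^-1].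
have mF n : measurable (F n).
  have mb : measurable_fun setT (fun x => ball_mass eps x <= n.+1%:R^-1).
    by apply: measurable_fun_ler; [exact: ball_mass_measurable|exact: measurable_cst].
  by rewrite -[X in measurable X]setTI; exact: mb.
have mFI : measurable (\bigcap_n F n) by exact: bigcapT_measurable.
have F0 : muX (\bigcap_n F n) = 0%E.
  apply: measure_negligible => //.
  apply: negligibleS (supp_setC_negligible hN muX) => x Fx /= /hsupp xs.
  have mass0 : 0 < ball_mass eps x.
    rewrite fine_gt0// xs//=.
    exact: (le_lt_trans (probability_le1 _ (is_norm_ball_measurable hN _ _)) (ltry 1)).
  have [n] := ltr_add_invr mass0; rewrite add0r => nx.
  by have := Fx n I; rewrite /F/= leNgt nx.
have Fcvg : muX (F n) @[n --> \oo] --> (0 : \bar R).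
  rewrite -F0; apply: nonincreasing_cvg_mu => //.
  - exact: (le_lt_trans (probability_le1 _ (mF 0%N)) (ltry 1)).
  - move=> i j ij; apply/subsetPset => x; rewrite /F/= => /le_trans; apply.
    by rewrite lef_pV2 ?posrE// ler_nat.
move/fine_cvg/cvgrPdist_le : Fcvg => /(_ _ tau0)[n _ /(_ n (leqnn n))] /=.
rewrite sub0r normrN ger0_norm ?fine_ge0// => Fn.
by exists n.+1%:R^-1; rewrite ?invr_gt0.
Qed.

End KnnError.

(** * Identification of [QI], choice of the parameters and passage to the limit *)

Theorem proposition4p5 (R : realType) (d e : nat)
    (N : 'rV[R]_d -> R) (hN : is_norm N)
    (dTh : measure_display) (Th : measurableType dTh)
    (f : 'rV[R]_d * Th -> 'rV[R]_e) (mf : measurable_fun setT f)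
    (phi : 'rV[R]_e -> R) (mphi : measurable_fun setT phi)
    (muX muX' : probability 'rV[R]_d R) (muTh : probability Th R)
    (dO : measure_display) (Omega : measurableType dO)
    (P : probability Omega R)
    (X : {RV P >-> 'rV[R]_d}) (Theta : {RV P >-> Th})
    (hX : has_law X muX) (hTheta : has_law Theta muTh)
    (hXTheta : mutually_independent P
                 (tnth [tuple sigma_rv X; sigma_rv Theta]))
    (X_ X'_ : nat -> {RV P >-> 'rV[R]_d}) (Theta_ : nat -> {RV P >-> Th})
    (hX_ : iid X_ muX) (hX'_ : iid X'_ muX') (hTheta_ : iid Theta_ muTh)
    (hindep : mutually_independent P
                (tnth [tuple sigma_seq X_; sigma_seq X'_; sigma_seq Theta_]))
    (QI : R) (hQI : QI = fine 'E_P[fun w => phi (f (X w, Theta w))])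
    (psi : 'rV[R]_d -> R)
    (hpsi : forall x, psi x = fine 'E_P[fun w => phi (f (x, Theta w))])
    (h1 : exists M : R, forall y, `|phi y| <= M)
    (h2 : exists L : R, forall x y, `|psi x - psi y| <= L * N (x - y))
    (h3 : supp N muX `<=` supp N muX')
    (h4 : exists m0 : nat, (1 <= m0)%N /\
       ('E_P[fun w => \big[Num.min/N (X'_ 0%N w)]_(j < m0) N (X'_ j w)]
          < +oo)%E)
    (h5 : ('E_P[fun w => (N (X w) ^+ 2)%R] < +oo)%E)
    (k : nat -> nat)
    (hk : forall m, (1 <= m)%N -> (1 <= k m <= m)%N)
    (hkoo : k m @[m --> \oo] --> \oo)
    (hk0 : (k m)%:R / m%:R @[m --> \oo] --> (0 : R)) :
  ('E_P[fun w => (`|knn_estimator N f phi (k nm.2) nm.2 nm.1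
                      (X_ ^~ w) (X'_ ^~ w) (Theta_ ^~ w) - QI| ^+ 2)%R]
     `^ 2^-1)%E @[nm --> filter_prod \oo \oo] --> (0%R%:E : \bar R).
Proof.
have [M hM] := h1; have [L hL] := h2.
have bphif : bounded_measurable (fun z => phi (f z)).
  by split; [exact: (measurableT_comp mphi mf)|exists M => z; exact: hM].
have bpsi := psi_bmf hN mf mphi hpsi hM hL.
have M0 : 0 <= M := le_trans (normr_ge0 _) (hM 0).
(* Freezing [X] and integrating over [Theta] alone shows that [phi (f (X, Theta)) - psi X] has mean
   0. *)
have QIE : QI = \int[muX]_x psi x.
  have bXT : bounded_measurable (fun w => phi (f (X w, Theta w))).
    exact: (bmf_comp bphif (measurable_fun_pair _ _)).
  have bX : bounded_measurable (fun w => psi (X w)) by exact: (bmf_comp bpsi).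
  rewrite hQI bmf_expectation//= -(has_law_Rintegral hX bpsi).
  apply/eqP; rewrite -subr_eq0 -RintegralB//; [|exact: bmf_integrable..].
  apply/eqP; pose h (z : 'rV[R]_d * Th) := phi (f z) - psi z.1.
  apply: (indep_Rintegral_eq0 (U := X) (W := Theta) (h := h)) => //.
  - by apply: bmfB => //; exact: (bmf_comp bpsi measurable_fst).
  - move=> A B mA mB; apply: (@mutually_independent2 _ _ _ _ _ _
      (@Ordinal 2 0 isT) (@Ordinal 2 1 isT) _ _ hXTheta) => //;
      exact: sigma_rv_preimage.
  - move=> x; rewrite /h/=.
    have bx : bounded_measurable (fun w => phi (f (x, Theta w))).
      exact: (bmf_comp bphif (measurable_fun_pair (measurable_cst x) _)).
    by rewrite bmf_RintegralB_cst// (psi_Rintegral mf mphi hpsi hM) subrr.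
pose Err (nm : nat * nat) := \int[P]_w ((knn_estimator N f phi (k nm.2) nm.2 nm.1
  (X_ ^~ w) (X'_ ^~ w) (Theta_ ^~ w) - QI) ^+ 2).
have Err_small tau : 0 < tau ->
    \forall nm \near filter_prod \oo \oo, Err nm <= tau.
  move=> tau0.
  (* Five contributions, each at most [t], multiplied by the factor 3 of [knn_second_moment]. *)
  pose t := tau / 15.
  have t0 : 0 < t by rewrite divr_gt0.
  (* Here and below, the [+ 1] added to expressions in [M] and [L] avoids separate cases when these
     vanish. *)
  pose eps := t / (2 * M * `|L| + 1).
  have d1 : 0 < 2 * M * `|L| + 1 by rewrite ltr_wpDl// !mulr_ge0.
  have eps0 : 0 < eps by rewrite divr_gt0.
  have d2 : 0 < 4 * M ^+ 2 + 1 by rewrite ltr_wpDl// mulr_ge0// sqr_ge0.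
  have [delta delta0 hdelta] := small_ball_mass hN eps0 h3 (divr_gt0 t0 d2).
  have delta20 : 0 < delta ^+ 2 by rewrite exprn_gt0.
  (* [K] is the threshold for both [k m] and [n], making [4 * M ^+ 2 / k] and [4 * M ^+ 2 / n] at
     most [t]; [m1] does the same for the Chebyshev term. *)
  pose K := (4 * M ^+ 2 + 1) / t.
  pose m1 := (4 * M ^+ 2 + 1) * 4 / (delta ^+ 2 * t).
  have kK : \forall m \near \oo, K <= (k m)%:R.
    exact: (hkoo _ (nbhs_infty_ger K)).
  have km2 : \forall m \near \oo, (k m)%:R / m%:R <= delta / 2.
    have /cvgrPdist_le/(_ _ (divr_gt0 delta0 (ltr0Sn R 1))) [m2 _ hm2] := hk0.
    exists m2 => // m /hm2 /=; rewrite sub0r normrN; apply: le_trans.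
    exact: ler_norm.
  have mm1 : \forall m \near \oo, m1 <= m%:R by exact: nbhs_infty_ger.
  have nK : \forall n \near \oo, K <= n%:R by exact: nbhs_infty_ger.
  have pos : \forall m \near \oo, (0 < m)%N by exact: nbhs_infty_gt.
  exists ([set n | K <= n%:R /\ (0 < n)%N],
    [set m | [/\ K <= (k m)%:R, (k m)%:R / m%:R <= delta / 2, m1 <= m%:R & (0 < m)%N]]).
    split => /=; first by near=> n; split; near: n.
    by near=> m; split; near: m.
  move=> [n m] /= [[Kn n0] [Kk kmd m1m m0]]; rewrite /Err/=.
  have /andP[k0 km] := hk m m0.
  have mr : (0 : R) < m%:R by rewrite ltr0n.
  have nr : (0 : R) < n%:R by rewrite ltr0n.
  have kr : (0 : R) < (k m)%:R by rewrite ltr0n.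
  have kmd' : (k m)%:R <= m%:R * delta / 2.
    by move: kmd; rewrite ler_pdivrMr// mulrC mulrA.
  apply: le_trans (knn_second_moment hN mf mphi hTheta hX_ hX'_ hTheta_ hindep
    hpsi hM hL QIE (ltW eps0) delta0 n0 (hk m m0) kmd') _.
  set a := fine _ in hdelta *.
  have frac (x y : R) : 0 <= x -> 0 < y -> (x + 1) / t <= y -> x / y <= t.
    move=> x0 y0; rewrite ler_pdivrMr// ler_pdivrMr// (mulrC t) => xy.
    by apply: le_trans xy; rewrite lerDl.
  have MM0 : 0 <= 4 * M ^+ 2 by rewrite mulr_ge0// sqr_ge0.
  have A := frac _ _ MM0 kr Kk.
  have B := frac _ _ MM0 nr Kn.
  have C : 2 * M * `|L| * eps <= t.
    rewrite /eps mulrA ler_pdivrMr// mulrC ler_pM2l// lerDl//.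
  have D : 4 * M ^+ 2 * a <= t.
    move: hdelta; rewrite ler_pdivlMr// => aD; apply: le_trans aD.
    by rewrite mulrC ler_wpM2l ?lerDl// fine_ge0.
  have E : 4 * M ^+ 2 * (4 / (m%:R * delta ^+ 2)) <= t.
    have mt : 0 < m%:R * delta ^+ 2 by rewrite mulr_gt0.
    rewrite mulrA ler_pdivrMr//.
    move: m1m; rewrite /m1 ler_pdivrMr ?mulr_gt0// => m1m.
    rewrite (_ : t * _ = m%:R * (delta ^+ 2 * t)); last by ring.
    by apply: le_trans m1m; lra.
  by move: A B C D E; rewrite /t; nra.
have Err0 nm : 0 <= Err nm by apply: Rintegral_ge0 => w _; exact: sqr_ge0.
rewrite (_ : (fun nm => _) = EFin \o (fun nm => Num.sqrt (Err nm))); last first.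
  apply/funext => nm /=; rewrite -powR12_sqrt// -poweR_EFin; congr (_ `^ _)%E.
  under eq_fun do rewrite real_normK ?num_real//.
  rewrite bmf_expectation//; apply: bmfX; apply: bmfB; last exact: bmf_cst.
  exact: knn_estimator_bmf.
apply: cvg_EFin; first by near=> nm.
apply/cvgrPdist_le => tau tau0.
(* The tolerance is squared because the norm is the square root of [Err]. *)
have [[A B] [nA nB] AB] := Err_small (tau ^+ 2) (exprn_gt0 2 tau0).
exists (A, B) => // nm /AB /= Etau.
rewrite sub0r normrN ger0_norm ?sqrtr_ge0//.
by rewrite -(ger0_norm (ltW tau0)) -sqrtr_sqr ler_sqrt// sqr_ge0.
Unshelve. all: by end_near.
Qed.
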